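(* Let $G$ be a connected graph on $n$ vertices. If $G$ contains $\left\lfloor\frac n3\right\rfloor$ pairwise vertex-disjoint paths of length $2$, then $\dim(S(G))\le\left\lceil\frac{2n}{3}\right\rceil$.
   Context: Graphs are finite, simple and undirected. A path of length $2$ in $G$ is a (not necessarily induced) path with two edges and three vertices. The subdivision graph $S(G)$ is obtained from $G$ by subdividing every edge exactly once, i.e. every edge $uv$ is removed and replaced by a new vertex $w$ together with the edges $uw$ and $wv$. For a connected graph $H$, $d_H(x,y)$ is the length of a shortest $x$-$y$ path. A set $S\subseteq V(H)$ is a metric generator for $H$ if for any two distinct vertices $x,y\in V(H)$ there is $v\in S$ with $d_H(x,v)\neq d_H(y,v)$; the metric dimension $\dim(H)$ is the minimum cardinality of a metric generator for $H$. *)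

(* Defs.v *)
(* Finite, simple, undirected graphs in the MathComp world. *)
From mathcomp Require Import all_boot.

Set Implicit Arguments.
Unset Strict Implicit.
Unset Printing Implicit Defensive.

Record sgraph := SGraph {
  vertex :> finType;
  adj : rel vertex;
  adj_sym : symmetric adj;
  adj_irrefl : irreflexive adj }.

Definition connected (G : sgraph) : Prop :=
  forall x y : G, connect (@adj G) x y.

(* A path is given by the sequence of its (distinct) vertices, so its length  *)
(* is one less than the size of the sequence. It need not be induced.         *)
Definition gpath (G : sgraph) (s : seq G) : bool :=
  uniq s && sorted (@adj G) s.

(* The path is x :: p, of length size p. *)
Definition xypath (G : sgraph) (x y : G) (p : seq G) : bool :=
  gpath (x :: p) && (last x p == y).

(* The least k < #|G| such that there is an x-y path of length k; the         *)
(* irrelevant default value is #|G| if x and y are not connected.             *)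
Definition dist (G : sgraph) (x y : G) : nat :=
  find (fun k => [exists p : k.-tuple G, xypath x y p]) (iota 0 #|G|).

Definition metric_generator (G : sgraph) (S : {set G}) : bool :=
  [forall x : G, forall y : G,
     (x != y) ==> [exists v in S, dist x v != dist y v]].

Definition metric_dim (G : sgraph) : nat :=
  #|[arg min_(S < [set: G] | metric_generator S) #|S| ]|.

Definition has_disjoint_paths2 (G : sgraph) (k : nat) : Prop :=
  exists P : 'I_k -> 3.-tuple G,
    (forall i, gpath (P i)) /\
    (forall i j, i != j -> [disjoint P i & P j]).

Definition edges (G : sgraph) : {set {set G}} :=
  [set [set u.1; u.2] | u : G * G & adj u.1 u.2].

(* The subdivision graph: the new vertex on the edge uv is inr [set u; v].    *)
Definition subdiv_vertex (G : sgraph) : finType :=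
  (G + {A : {set G} | A \in edges G})%type.

Definition subdiv_adj (G : sgraph) : rel (subdiv_vertex G) :=
  fun a b => match a, b with
  | inl u, inr A => u \in val A
  | inr A, inl u => u \in val A
  | _, _ => false
  end.

Lemma subdiv_adj_sym (G : sgraph) : symmetric (@subdiv_adj G).
Proof. by case=> [u|A] [v|B]. Qed.

Lemma subdiv_adj_irrefl (G : sgraph) : irreflexive (@subdiv_adj G).
Proof. by case. Qed.

Definition subdivision (G : sgraph) : sgraph :=
  SGraph (@subdiv_adj_sym G) (@subdiv_adj_irrefl G).

Definition ceil_div (m d : nat) : nat := (m + d.-1) %/ d.

Lemma ceil_div_leq m d k : 0 < d -> (ceil_div m d <= k) = (m <= k * d).
Proof.
by case: d => // d _; rewrite /ceil_div /= -ltnS ltn_divLR // mulSn addSn ltnS addnC leq_add2l.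
Qed.

Lemma xypath_size (G : sgraph) (x y : G) p : xypath x y p -> size p < #|G|.
Proof.
case/andP=> /andP[Up _] _.
by have := max_card (mem (x :: p)); rewrite (card_uniqP Up).
Qed.

Lemma dist_le (G : sgraph) (x y : G) p : xypath x y p -> dist x y <= size p.
Proof.
move=> xyp; rewrite leqNgt; apply/negP=> lt_p.
have := before_find 0 lt_p; rewrite nth_iota ?(xypath_size xyp) // add0n.
by move/negbT/existsPn/(_ (in_tuple p)); rewrite xyp.
Qed.

Lemma dist_attained (G : sgraph) (x y : G) :
  connect (@adj G) x y -> exists2 p, xypath x y p & size p = dist x y.
Proof.
case/connectP=> q xq ->; case/shortenP: xq => p xp Up _ {q}.
have xyp : xypath x (last x p) p by rewrite /xypath /gpath Up /= xp eqxx.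
pose a k := [exists q : k.-tuple G, xypath x (last x p) q].
have hasa : has a (iota 0 #|G|).
  apply/hasP; exists (size p); first by rewrite mem_iota (xypath_size xyp).
  by apply/existsP; exists (in_tuple p).
have := nth_find 0 hasa; rewrite has_find size_iota in hasa.
by rewrite nth_iota // add0n => /existsP[q xyq]; exists q => //; rewrite size_tuple.
Qed.

Lemma dist_xx (G : sgraph) (x : G) : dist x x = 0.
Proof. by apply/eqP; rewrite -leqn0 (@dist_le G x x [::]) // /xypath /= eqxx. Qed.

Lemma dist_eq0 (G : sgraph) (x y : G) : dist x y = 0 -> x = y.
Proof.
move=> d0; have hasa : dist x y < #|G| by rewrite d0; apply/card_gt0P; exists x.
rewrite -[X in _ < X](size_iota 0) -has_find in hasa.
have := nth_find 0 hasa; rewrite -/(dist x y) d0 nth_iota; last by apply/card_gt0P; exists x.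
by case/existsP=> p; rewrite (tuple0 p) => /andP[_ /eqP].
Qed.

Lemma metric_generatorT (G : sgraph) : metric_generator [set: G].
Proof.
apply/forallP=> x; apply/forallP=> y; apply/implyP=> neq_xy.
apply/existsP; exists x; rewrite inE dist_xx eq_sym.
by apply: contraNneq neq_xy => /dist_eq0->.
Qed.

Lemma metric_dim_attained (G : sgraph) :
  exists2 S : {set G}, metric_generator S & #|S| = metric_dim G.
Proof.
by rewrite /metric_dim; case: arg_minnP => [|S gS _]; [exact: metric_generatorT | exists S].
Qed.

Lemma metric_dim_le (G : sgraph) (S : {set G}) :
  metric_generator S -> metric_dim G <= #|S|.
Proof.
by rewrite /metric_dim; case: arg_minnP => [|S0 _ minS]; [exact: metric_generatorT | exact: minS].
Qed.

Lemma subdivision_connected (G : sgraph) :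
  connected G -> connected (subdivision G).
Proof.
move=> cG; set S := subdivision G.
have csym : connect_sym (@adj S) by apply: sym_connect_sym; exact: adj_sym.
have step (u v : G) : adj u v -> connect (@adj S) (inl u) (inl v).
  move=> uv; have Euv : [set u; v] \in edges G.
    by apply/imsetP; exists (u, v); rewrite ?inE.
  apply: (@connect_trans _ _ (inr (Sub [set u; v] Euv) : S)).
    by apply: connect1; rewrite /= set21.
  by apply: connect1; rewrite /= set22.
have old (u v : G) : connect (@adj S) (inl u) (inl v).
  case/connectP: (cG u v) => p; elim: p u => [|w p IHp] u /=; first by move=> _ ->.
  by case/andP=> /step uw wp /IHp-/(_ wp); apply: connect_trans.
have toold (a : S) : exists u : G, connect (@adj S) a (inl u).
  case: a => [u|[A EA]]; first by exists u.
  case/imsetP: (EA) => -[u v] _ defA; exists u; apply: connect1.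
  by rewrite /= defA set21.
move=> a b; have [u au] := toold a; have [v bv] := toold b.
by rewrite (connect_trans au) // (connect_trans (old u v)) // csym.
Qed.

(* Main.v *)
Require Import Defs.
From mathcomp Require Import all_boot.
From mathcomp Require Import zify.

(** Write the disjoint paths as [a i, b i, c i], with middle vertex [b i]. In
    the subdivision graph take as landmarks the two new vertices on the edges
    of each path, together with the old vertices that lie on no path. With
    [k = n %/ 3] paths there are at most [2 * k + (n - 3 * k) = n - k]
    landmarks, which is the ceiling of [2 * n / 3].

    To see that they resolve, it is enough to know which distances to them are
    equal to 0, 1 and 2. Distance 0 singles out the landmarks. A new vertex has
    even distance to a landmark edge and an old vertex odd distance, the value
    1 meaning that the old vertex is an end of that edge; an old vertex on the
    path [i] is therefore recognised by the edges of that path to which it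
    belongs: the first, the second, or both. Finally, a new vertex on the edge
    [A] is at distance 2 from another new vertex exactly when the two edges
    share an end, so the landmarks tell which path edges [A] meets and which
    vertices off the paths it contains. This determines [A]
    ([edge_determined]). The only possible confusion is between the chord
    [a i, c i] and an edge that contains [b i], as both meet both edges of the
    path; but the second end of the latter edge lies outside the path, where
    some landmark detects it ([chord_not_middle]). *)

(** * Short distances *)

Lemma dist_eq1 {H : sgraph} {x y : H} :
  connected H -> (dist x y == 1) = adj x y.
Proof.
move=> cH; apply/eqP/idP => [d1 | xy].
  have [p xyp] := dist_attained (cH x y); rewrite d1.
  by case: p xyp => [|z []] //= /andP[/andP[_ /=]]; rewrite andbT => xz /eqP<-.
have neq_xy : x != y by apply: contraTneq xy => ->; rewrite adj_irrefl.
have le1 : dist x y <= 1.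
  by apply: (@dist_le H x y [:: y]); rewrite /xypath /gpath /= inE neq_xy xy eqxx.
by case: (dist x y) le1 (@dist_eq0 H x y) neq_xy => [_ -> //|[]//]; rewrite eqxx.
Qed.

Lemma dist_eq2 {H : sgraph} {x y : H} :
  connected H -> x != y -> ~~ adj x y ->
  (dist x y == 2) = [exists w, adj x w && adj w y].
Proof.
move=> cH neq_xy nxy; apply/eqP/existsP => [d2 | [w /andP[xw wy]]].
  have [p xyp] := dist_attained (cH x y); rewrite d2.
  case: p xyp => [|w [|z []]] //= /andP[/andP[_ /= /and3P[xw wz _]] /eqP<-] _.
  by exists w; rewrite xw.
have neq_xw : x != w by apply: contraTneq xw => ->; rewrite adj_irrefl.
have neq_wy : w != y by apply: contraTneq wy => ->; rewrite adj_irrefl.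
have le2 : dist x y <= 2.
  apply: (@dist_le H x y [:: w; y]).
  by rewrite /xypath /gpath /= !inE negb_or neq_xw neq_xy neq_wy xw wy eqxx.
have ne1 : dist x y != 1 by rewrite dist_eq1.
by case: (dist x y) le2 ne1 (@dist_eq0 H x y) neq_xy => [_ _ -> //|[|[]]//]; rewrite eqxx.
Qed.

(** Two new vertices are joined by a path of length 2 exactly through a common
    end of their edges, so a landmark edge detects the edges that touch it. *)
Lemma dist_new_new {G : sgraph} (A B : {A : {set G} | A \in edges G}) :
  connected G -> A != B ->
  (@dist (subdivision G) (inr A) (inr B) == 2) = [exists x in val A, x \in val B].
Proof.
move=> cG neqAB; rewrite (dist_eq2 (subdivision_connected cG)) //.
apply/existsP/existsP => [[[x|//] xAB] | [x xAB]]; first by exists x.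
by exists (inl x).
Qed.

Lemma card_edge {G : sgraph} (A : {A : {set G} | A \in edges G}) :
  #|val A| = 2.
Proof.
case: A => A /= /imsetP[[u v]]; rewrite inE /= => uv ->.
by rewrite cards2; case: eqP uv => // ->; rewrite adj_irrefl.
Qed.

(** * Pairs of vertices and disjoint triples *)

Lemma pair_eq {V : finType} {X : {set V}} {x y : V} :
  #|X| = 2 -> x \in X -> y \in X -> x != y -> X = [set x; y].
Proof.
move=> X2 xX yX neq_xy; apply/esym/eqP; rewrite eqEcard cards2 neq_xy X2 andbT.
by apply/subsetP=> z /set2P[] ->.
Qed.

Lemma exists_in_set2 {V : finType} (X : {set V}) (x y : V) :
  [exists z in X, z \in [set x; y]] = (x \in X) || (y \in X).
Proof.
apply/existsP/orP => [[z /andP[zX /set2P[]<-]] | []]; try by auto.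
  by exists x; rewrite set21 andbT.
by exists y; rewrite set22 andbT.
Qed.

(** The relation that equal distances to all landmarks impose on two edges
    that are not themselves path edges: the same ends off the paths, and the
    same path edges touched. *)
Definition same_trace {V I : finType} (a b c : I -> V) (X Y : {set V}) :=
  [/\ forall z, (forall i, z \notin [:: a i; b i; c i]) -> (z \in X) = (z \in Y),
      forall i, (a i \in X) || (b i \in X) = (a i \in Y) || (b i \in Y)
    & forall i, (b i \in X) || (c i \in X) = (b i \in Y) || (c i \in Y)].

Lemma same_trace_sym {V I : finType} {a b c : I -> V} {X Y : {set V}} :
  same_trace a b c X Y -> same_trace a b c Y X.
Proof. by case=> t1 t2 t3; split=> [z /t1|i|i]; rewrite ?t2 ?t3 // => ->. Qed.

Definition no_path_edge {V I : finType} (a b c : I -> V) (X : {set V}) :=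
  forall i, X != [set a i; b i] /\ X != [set b i; c i].

(** The second end of [Y] cannot lie on the path [i], since [Y] is not a path
    edge. Hence it is off all the paths or on another path; either way [X]
    would have a vertex there too. *)
Lemma chord_not_middle {V I : finType} {a b c : I -> V} {X Y : {set V}} {i : I} :
  (forall i, uniq [:: a i; b i; c i]) ->
  (forall i j x, x \in [:: a i; b i; c i] -> x \in [:: a j; b j; c j] -> i = j) ->
  #|X| = 2 -> #|Y| = 2 -> no_path_edge a b c Y -> same_trace a b c X Y ->
  a i \in X -> c i \in X -> b i \in Y -> False.
Proof.
move=> U D X2 Y2 nY [t1 t2 t3] aX cX bY.
have := U i; rewrite /= !inE negb_or andbT => /andP[/andP[ab ac] bc].
have defX := pair_eq X2 aX cX ac.
have [v vY vb] : exists2 v, v \in Y & v != b i.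
  have /card_gt0P[v] : 0 < #|Y :\ b i|.
    by have := cardsD1 (b i) Y; rewrite bY Y2; case: #|_|.
  by rewrite !inE => /andP[]; exists v.
have [nab nbc] := nY i.
have va : v != a i.
  by apply: contraNneq nab => va; rewrite (pair_eq Y2 vY bY vb) va.
have vc : v != c i.
  by apply: contraNneq nbc => vc; rewrite (pair_eq Y2 vY bY vb) vc setUC.
have vX : v \notin X by rewrite defX !inE negb_or va vc.
have [/existsP[j vj] | /existsPn nv] := boolP [exists j, v \in [:: a j; b j; c j]];
  last by rewrite t1 ?vY in vX.
have [x xX xj] : exists2 x, x \in X & x \in [:: a j; b j; c j].
  have /orP[] : (a j \in X) || (b j \in X) || ((b j \in X) || (c j \in X)).
  - rewrite t2 t3; move: vj vY.
    by rewrite !inE => /or3P[] /eqP<- ->; rewrite ?orbT.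
  - by case/orP; [exists (a j) | exists (b j)]; rewrite ?inE ?eqxx ?orbT.
  by case/orP; [exists (b j) | exists (c j)]; rewrite ?inE ?eqxx ?orbT.
have eq_ij : i = j.
  apply: D xj; move: xX; rewrite defX !inE.
  by case/orP=> ->; rewrite ?orbT.
by move: vj; rewrite -eq_ij !inE (negPf va) (negPf vb) (negPf vc).
Qed.

(** An end [u] of [X] off the paths is seen directly. For [u] on the path [i],
    the answers for the two edges of that path leave only the possibilities
    that [u] is in [Y], or that one of [X], [Y] is the chord [a i, c i] and the
    other contains [b i], which [chord_not_middle] excludes. *)
Lemma edge_determined {V I : finType} {a b c : I -> V} {X Y : {set V}} :
  (forall i, uniq [:: a i; b i; c i]) ->
  (forall i j x, x \in [:: a i; b i; c i] -> x \in [:: a j; b j; c j] -> i = j) ->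
  #|X| = 2 -> #|Y| = 2 -> no_path_edge a b c X -> no_path_edge a b c Y ->
  same_trace a b c X Y -> X = Y.
Proof.
move=> U D X2 Y2 nX nY tXY; have [t1 t2 t3] := tXY.
have nch i := @chord_not_middle V I a b c _ _ i U D X2 Y2 nY tXY.
have nchC i :=
  @chord_not_middle V I a b c _ _ i U D Y2 X2 nX (same_trace_sym tXY).
apply/eqP; rewrite eqEcard X2 Y2 leqnn andbT; apply/subsetP=> u uX.
have [/existsP[i ui] | /existsPn nu] := boolP [exists i, u \in [:: a i; b i; c i]];
  last by rewrite -t1.
have := U i; rewrite /= !inE negb_or andbT => /andP[/andP[ab ac] bc].
have nabX : ~~ ((a i \in X) && (b i \in X)).
  by apply/negP=> /andP[aX bX]; case: (nX i); rewrite (pair_eq X2 aX bX ab) eqxx.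
have nbcX : ~~ ((b i \in X) && (c i \in X)).
  by apply/negP=> /andP[bX cX]; case: (nX i); rewrite (pair_eq X2 bX cX bc) eqxx.
have := t2 i; have := t3 i; have := nch i; have := nchC i.
move: nabX nbcX; move: ui uX; rewrite !inE => /or3P[] /eqP-> ->.
(* What remains is propositional in the memberships of the three vertices. *)
all: case: (a i \in Y); case: (b i \in Y); case: (c i \in Y);
  case: (a i \in X); case: (b i \in X); case: (c i \in X) => //= _ _ h1 h2 _ _.
all: by [case: h1 | case: h2].
Qed.

(** * The landmarks *)

Definition path_edges {V I : finType} (a b c : I -> V) : {set {set V}} :=
  [set [set a i; b i] | i : I] :|: [set [set b i; c i] | i : I].

Definition landmarks {G : sgraph} {I : finType} (a b c : I -> G) :
    {set subdivision G} :=
  [set w : subdivision G | match w with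
    | inl z => [forall i, z \notin [:: a i; b i; c i]]
    | inr A => val A \in path_edges a b c
    end].

(** Replacing the three vertices of each path by its two edges saves one
    landmark per path, compared with taking all the old vertices. *)
Lemma card_landmarks {G : sgraph} {I : finType} (a b c : I -> G) :
  (forall i, uniq [:: a i; b i; c i]) ->
  (forall i j x, x \in [:: a i; b i; c i] -> x \in [:: a j; b j; c j] -> i = j) ->
  #|landmarks a b c| + #|I| <= #|G|.
Proof.
move=> U D.
pose T := \bigcup_i [set x in [:: a i; b i; c i]].
have cardT : #|T| = 3 * #|I|.
  rewrite /T -sum1_card partition_disjoint_bigcup => [|i j neq_ij].
    under eq_bigr do rewrite sum1_card cardsE (card_uniqP (U _)).
    by rewrite /= sum_nat_const mulnC.
  rewrite -setI_eq0; apply/eqP/setP=> x; rewrite !in_set0 in_setI !in_set.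
  by apply: contraNF neq_ij => /andP[/D xi /xi ->].
pose E := path_edges a b c.
have cardE : #|E| <= 2 * #|I|.
  rewrite mul2n -addnn (leq_trans (leq_card_setU _ _)) //.
  by rewrite leq_add ?leq_imset_card.
pose F := [set A : {A : {set G} | A \in edges G} | val A \in E].
have cardF : #|F| <= #|E|.
  rewrite -(card_imset (mem F) val_inj) subset_leq_card //.
  by apply/subsetP=> A /imsetP[B]; rewrite inE => BE ->.
have sub : landmarks a b c \subset
    [set (inl z : subdivision G) | z in ~: T] :|:
    [set (inr A : subdivision G) | A in F].
  apply/subsetP=> -[z|A]; rewrite in_setU inE => w; apply/orP; [left | right].
    apply: imset_f; rewrite inE; apply/bigcupP=> -[i _].
    by rewrite inE; apply/negP/(forallP w).
  by apply: imset_f; rewrite inE.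
have leW : #|landmarks a b c| <= #|~: T| + 2 * #|I|.
  apply: leq_trans (subset_leq_card sub) _.
  apply: leq_trans (leq_card_setU _ _) _.
  rewrite leq_add ?leq_imset_card //.
  by rewrite (leq_trans (leq_imset_card _ _)) // (leq_trans cardF).
rewrite -(cardsC T) cardT.
by rewrite mulSn -addnA [leqLHS]addnC leq_add2l addnC.
Qed.

(** Parity of distances separates old from new vertices, but the value 1
    suffices: an old vertex that is not a landmark is adjacent to some landmark
    edge, and a new vertex to none. Two old vertices are then compared through
    adjacency, two new ones through [dist_new_new] and [edge_determined]. *)
Lemma landmarks_resolve {G : sgraph} {I : finType} (a b c : I -> G) :
  connected G ->
  (forall i, adj (a i) (b i)) -> (forall i, adj (b i) (c i)) ->
  (forall i, uniq [:: a i; b i; c i]) ->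
  (forall i j x, x \in [:: a i; b i; c i] -> x \in [:: a j; b j; c j] -> i = j) ->
  metric_generator (landmarks a b c).
Proof.
move=> cG adj_ab adj_bc U D; have cS := subdivision_connected cG.
have Eab i : [set a i; b i] \in edges G.
  by apply/imsetP; exists (a i, b i); rewrite ?inE ?adj_ab.
have Ebc i : [set b i; c i] \in edges G.
  by apply/imsetP; exists (b i, c i); rewrite ?inE ?adj_bc.
pose ab i : subdivision G := inr (exist _ [set a i; b i] (Eab i)).
pose bc i : subdivision G := inr (exist _ [set b i; c i] (Ebc i)).
have PEab i : [set a i; b i] \in path_edges a b c.
  by apply/setUP; left; apply: imset_f.
have PEbc i : [set b i; c i] \in path_edges a b c.
  by apply/setUP; right; apply: imset_f.
have Lab i : ab i \in landmarks a b c by rewrite inE; apply: PEab.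
have Lbc i : bc i \in landmarks a b c by rewrite inE; apply: PEbc.
have same_eq (x y : subdivision G) :
    {in landmarks a b c, forall w, dist x w = dist y w} -> x = y; last first.
  apply/forallP=> x; apply/forallP=> y; apply/implyP; apply: contraR.
  rewrite negb_exists => /forallP same; apply/eqP/same_eq => w Lw.
  by have := same w; rewrite Lw negbK => /eqP.
move=> same.
have at0 w : w \in landmarks a b c -> (x == w) || (y == w) -> x = y.
  move=> Lw /orP[]/eqP eq_w; have := same w Lw; rewrite eq_w dist_xx.
    by move/esym/dist_eq0.
  by move/dist_eq0.
have at1 w : w \in landmarks a b c -> adj x w = adj y w.
  by move=> Lw; rewrite -!(dist_eq1 cS) (same w Lw).
have covered (z : G) : inl z \notin landmarks a b c ->
    exists i, z \in [:: a i; b i; c i].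
  by rewrite inE => /forallPn[i]; rewrite negbK; exists i.
have [/orP Lxy | ] := boolP ((x \in landmarks a b c) || (y \in landmarks a b c)).
  by case: Lxy => /at0; apply; rewrite eqxx ?orbT.
rewrite negb_or => /andP[].
case: x y same at0 at1 => [u|A] [v|B] same at0 at1 nLx nLy.
- have [i ui] := covered u nLx; congr inl.
  (* The first, middle and last vertex of the path belong to its first edge
     only, to both edges, and to its second edge only. *)
  have := U i; rewrite /= !inE negb_or andbT => /andP[/andP[ab_ ac_] bc_].
  have := at1 _ (Lab i); have := at1 _ (Lbc i); rewrite /= !inE.
  move: ui; rewrite !inE => /or3P[]/eqP->.
  + rewrite eqxx (negPf ab_) (negPf ac_) /=.
    by move/esym/norP=> [/negPf-> _]; rewrite orbF => /esym/eqP.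
  + rewrite eqxx orbT => /esym/orP[/eqP-> //|/eqP->].
    by rewrite eq_sym (negPf ac_) eq_sym (negPf bc_).
  + rewrite eqxx orbT ![c i == _]eq_sym (negPf ac_) (negPf bc_) /=.
    by move/esym=> vbc /esym/norP[_ nvb]; move: vbc; rewrite (negPf nvb) => /eqP.
- have [i] := covered u nLx; rewrite !inE => /or3P[]/eqP ui.
  + by have := at1 _ (Lab i); rewrite /= ui set21.
  + by have := at1 _ (Lab i); rewrite /= ui set22.
  + by have := at1 _ (Lbc i); rewrite /= ui set22.
- have [i] := covered v nLy; rewrite !inE => /or3P[]/eqP vi.
  + by have := at1 _ (Lab i); rewrite /= vi set21.
  + by have := at1 _ (Lab i); rewrite /= vi set22.
  + by have := at1 _ (Lbc i); rewrite /= vi set22.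
have meet (C : {A : {set G} | A \in edges G}) : val C \in path_edges a b c ->
    [exists x in val A, x \in val C] = [exists x in val B, x \in val C].
  move=> CL; have LC : inr C \in landmarks a b c by rewrite inE.
  rewrite -!dist_new_new ?(same _ LC) //.
    by apply: contraNneq nLy => ->.
  by apply: contraNneq nLx => ->.
have not_path_edge (C : {A : {set G} | A \in edges G}) :
    inr C \notin landmarks a b c -> no_path_edge a b c (val C).
  rewrite inE => nC i; split; apply: contraNneq nC => ->.
    exact: PEab.
  exact: PEbc.
congr inr; apply: val_inj; apply: (edge_determined U D); rewrite ?card_edge //.
- exact: not_path_edge.
- exact: not_path_edge.
split=> [z nz | i | i].
- by apply: (at1 (inl z)); rewrite inE; apply/forallP.
- rewrite -!exists_in_set2.
  exact: (meet (exist (fun A => A \in edges G) _ (Eab i)) (PEab i)).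
rewrite -!exists_in_set2.
exact: (meet (exist (fun A => A \in edges G) _ (Ebc i)) (PEbc i)).
Qed.

Theorem theorem2 (G : sgraph) (n : nat) (hn : #|G| = n) (hG : connected G)
    (hP : has_disjoint_paths2 G (n %/ 3)) :
  metric_dim (subdivision G) <= ceil_div (2 * n) 3.
Proof.
have [P [pathP disjP]] := hP.
pose a i := tnth (P i) (inord 0); pose b i := tnth (P i) (inord 1).
pose c i := tnth (P i) (inord 2).
have defP i : P i = [:: a i; b i; c i] :> seq G.
  by rewrite /a /b /c !(tnth_nth (a i)) !inordK //; case: (P i) => -[|? [|? [|? []]]].
have U i : uniq [:: a i; b i; c i] by rewrite -defP; case/andP: (pathP i).
have D i j x : x \in [:: a i; b i; c i] -> x \in [:: a j; b j; c j] -> i = j.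
  rewrite -!defP => xi xj; apply/eqP; apply: contraTT xj => /disjP dij.
  by rewrite (disjointFr dij).
have adj_ab i : adj (a i) (b i).
  by have /andP[_] := pathP i; rewrite defP => /and3P[].
have adj_bc i : adj (b i) (c i).
  by have /andP[_] := pathP i; rewrite defP => /and3P[].
have le_dim := metric_dim_le (landmarks_resolve a b c hG adj_ab adj_bc U D).
apply: leq_trans le_dim _; rewrite /ceil_div leq_divRL //.
have := card_landmarks a b c U D; rewrite card_ord hn; lia.
Qed.
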